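(* The full subcategory $\mathsf{F}:=\{\mathbf{1},\,\mathbb{N}\langle k\rangle\mid k\in \omega\}$ of $\mathsf{QCB_0}$ is cartesian closed and closed under finite $\mathsf{QCB_0}$-product. Moreover, $\mathsf{F}$ is the smallest such subcategory in the following sense: if $\mathsf{C}$ is a full cartesian closed subcategory of $\mathsf{QCB_0}$ which is closed under finite product inherited from $\mathsf{QCB_0}$ and contains the space $\omega$ as an object, then any $\mathsf{F}$-object is homeomorphic to a $\mathsf{C}$-object.
   Context: $\mathsf{QCB_0}$ is the cartesian closed category of qcb$_0$-spaces ($T_0$ quotients of countably based spaces) with continuous maps; $\mathbf{1}$ is a fixed one-point space. The Kleene-Kreisel continuous functionals of finite types are $\mathbb{N}\langle 0\rangle:=\omega$ (discrete) and $\mathbb{N}\langle k+1\rangle:=\omega^{\mathbb{N}\langle k\rangle}$, the $\mathsf{QCB_0}$-exponential (continuous maps with the sequentialization of the compact-open topology). *)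

(* Defs.v *)
From HB Require Import structures.
From mathcomp Require Import all_boot all_order.
From mathcomp Require Import all_classical all_reals all_analysis.

Set Implicit Arguments.
Unset Strict Implicit.
Unset Printing Implicit Defensive.

Local Open Scope classical_set_scope.

(* Carrier alias: [sequentialization T] is [T] with the topology of the
   sequentially open subsets of [T]. *)
Definition sequentialization (T : Type) : Type := T.

Section Sequentialization.
Variable T : topologicalType.

Definition seq_open (U : set T) : Prop :=
  forall (u : nat -> T) (x : T), U x -> u @ \oo --> x -> \forall n \near \oo, U (u n).

Lemma seq_openT : seq_open setT.
Proof. by move=> u x _ _; exact: filterT. Qed.

Lemma seq_openI : setI_closed seq_open.
Proof.
move=> A B oA oB u x [Ax Bx] ux.
by apply: filterI; [exact: oA ux|exact: oB ux].
Qed.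

Lemma seq_open_bigU (I : Type) (f : I -> set T) :
  (forall i, seq_open (f i)) -> seq_open (\bigcup_i f i).
Proof.
move=> of_ u x [i _ fix_] ux.
by apply: filterS (of_ i u x fix_ ux) => n fn; exists i.
Qed.

HB.instance Definition _ := Choice.on (sequentialization T).
HB.instance Definition _ := isOpenTopological.Build (sequentialization T)
  seq_openT seq_openI seq_open_bigU.

End Sequentialization.

Definition compact_open_space (X Y : topologicalType) : topologicalType :=
  initial_topology (fun f : continuousType X Y => (f : X -> Y) : {compact-open, X -> Y}).

Definition qcb_exp (Y X : topologicalType) : topologicalType :=
  sequentialization (compact_open_space X Y).

Definition one_space : topologicalType := discrete_topology unit.

Fixpoint kleene_kreisel (k : nat) : topologicalType :=
  if k is k'.+1 then qcb_exp nat (kleene_kreisel k') else nat.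

Definition homeomorphic (X Y : topologicalType) : Prop :=
  exists (f : continuousType X Y) (g : continuousType Y X), cancel f g /\ cancel g f.

Definition quotient_map (Z X : topologicalType) (q : Z -> X) : Prop :=
  (forall x, exists z, q z = x) /\ (forall U : set X, open U <-> open (q @^-1` U)).

Definition qcb0 (X : topologicalType) : Prop :=
  kolmogorov_space X /\
  exists (Z : topologicalType) (q : Z -> X), @second_countable Z /\ quotient_map q.

(* A full subcategory of topological spaces is given by its class of objects
   [K]; the morphisms are all continuous maps between objects of [K]. *)
Definition space_class := topologicalType -> Prop.

Definition full_subcategory (K L : space_class) : Prop := forall X, K X -> L X.

Definition is_terminal (K : space_class) (T : topologicalType) : Prop :=
  K T /\ forall X, K X -> exists! f : continuousType X T, True.

Definition is_product (K : space_class) (X Y P : topologicalType)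
    (p : continuousType P X) (q : continuousType P Y) : Prop :=
  K P /\
  forall W, K W -> forall (f : continuousType W X) (g : continuousType W Y),
    exists! h : continuousType W P, p \o h =1 f /\ q \o h =1 g.

(* [E] with [ev : P -> Z], where [P] is the product of [E] and [Y] in [K], is
   the exponential [Z^Y] in [K]. Below, [u] is the map [h x id_Y : A x Y -> E x Y],
   which is determined by its two projections. *)
Definition is_exponential (K : space_class) (Y Z E P : topologicalType)
    (p : continuousType P E) (q : continuousType P Y) (ev : continuousType P Z) :
    Prop :=
  [/\ K E, is_product K p q &
    forall (A Q : topologicalType) (r : continuousType Q A) (s : continuousType Q Y),
      K A -> is_product K r s ->
      forall f : continuousType Q Z,
        exists! h : continuousType A E,
          exists u : continuousType Q P,
            [/\ p \o u =1 h \o r, q \o u =1 s & ev \o u =1 f] ].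

Definition cartesian_closed (K : space_class) : Prop :=
  [/\ exists T, is_terminal K T,
      forall X Y, K X -> K Y ->
        exists (P : topologicalType) (p : continuousType P X) (q : continuousType P Y), is_product K p q &
      forall Y Z, K Y -> K Z ->
        exists (E P : topologicalType) (p : continuousType P E) (q : continuousType P Y)
               (ev : continuousType P Z), is_exponential K p q ev ].

(* Closure is up to isomorphism: some product formed in [L] is an object of [K]. *)
Definition closed_under_finite_products (L K : space_class) : Prop :=
  (exists2 T, K T & is_terminal L T) /\
  (forall X Y, K X -> K Y ->
     exists (P : topologicalType) (p : continuousType P X) (q : continuousType P Y),
       K P /\ is_product L p q).

Definition kleene_kreisel_category : space_class := fun X =>
  X = one_space \/ exists k, X = kleene_kreisel k.

(* Main.v *)
(* Every space involved is sequential, hence determined by its convergent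
   sequences.  A space [E] with [ev : E -> Y -> Z] behaves as an exponential as
   soon as convergence in [E] is continuous convergence, and [P] behaves as a
   product as soon as convergence in [P] is componentwise.

   Kleene-Kreisel spaces are qcb: a countable cs-network [(B_i)] of [Y] induces
   one of [nat^Y], given by finite intersections of the sets {f | f = m on B_i},
   and a sequential space with a countable cs-network is a quotient of a
   countably based one.  The compact-open topology has continuous convergence as
   its convergence because a countable dense set separates the points of [nat^Y],
   so that compact subsets of [nat^Y] are sequentially compact.

   Products: if [B] is a retract of [A], then [nat^B x nat^A] is homeomorphic to
   [nat^A], because the restriction of a functional to [B] can absorb another
   functional on [B].  Hence [N<j> x N<k>] is [N<max j k>], and currying gives
   the exponentials [nat^(N<k>) ^ N<j> = nat^(N<k> x N<j>)].

   Minimality: the exponential [A = nat^nat] of [C] maps bijectively and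
   continuously onto Baire space; being uncountable and qcb it is not discrete, so
   it contains a nontrivial convergent sequence, along which any convergent
   sequence of any object extends to a continuous map defined on [A].  Such test
   sequences force the exponentials of [C] to carry continuous convergence. *)

Require Import Defs.
From HB Require Import structures.
From mathcomp Require Import all_boot finmap.
From mathcomp Require Import all_classical all_reals all_analysis.

Set Implicit Arguments.
Unset Strict Implicit.
Unset Printing Implicit Defensive.

Local Open Scope classical_set_scope.

(** * Sequential spaces *)

Definition sequential (X : topologicalType) : Prop :=
  forall U : set X, seq_open U -> open U.

Lemma cvg_seqP (X : topologicalType) (u : nat -> X) (x : X) :
  u @ \oo --> x <->
  forall U : set X, open U -> U x -> \forall n \near \oo, U (u n).
Proof.
split=> [ux U oU Ux|H A]; first by apply: ux; exact: open_nbhs_nbhs.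
rewrite nbhsE => -[U [oU Ux] UA].
by have := H U oU Ux; apply: filterS => n /UA.
Qed.

Lemma cvg_natP (u : nat -> nat) (m : nat) :
  u @ \oo --> m <-> \forall n \near \oo, u n = m.
Proof.
split=> [/cvg_seqP um|um].
  by apply: (um [set m]) => //; exact: discrete_open.
by apply/cvg_seqP => U _ Um; apply: filterS um => n ->.
Qed.

Lemma near_subseq (P : nat -> Prop) (phi : nat -> nat) :
  (forall n, n <= phi n) ->
  (\forall n \near \oo, P n) -> \forall n \near \oo, P (phi n).
Proof.
move=> le_phi [N _ NP]; exists N => // n /= Nn.
by apply: NP => /=; exact: leq_trans Nn (le_phi n).
Qed.

(** The bound [n <= phi n] makes [phi] tend to infinity, which is the sense of subsequence used
    throughout. *)
Lemma not_near_ooP (P : nat -> Prop) :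
  ~ (\forall n \near \oo, P n) ->
  exists2 phi : nat -> nat, (forall n, n <= phi n) & forall n, ~ P (phi n).
Proof.
move=> nP.
have /choice[phi phiP] : forall N, exists n, N <= n /\ ~ P n.
  move=> N; apply: contrapT => H; apply: nP; exists N => // n /= Nn.
  by apply: contrapT => nPn; apply: H; exists n.
by exists phi => n; have [] := phiP n.
Qed.

Lemma cvg_subseq (X : topologicalType) (u : nat -> X) (x : X) (phi : nat -> nat) :
  (forall n, n <= phi n) -> u @ \oo --> x -> (fun n => u (phi n)) @ \oo --> x.
Proof.
move=> le_phi /cvg_seqP ux; apply/cvg_seqP => U oU Ux.
exact: (near_subseq (P := fun n => U (u n)) le_phi) (ux U oU Ux).
Qed.

Lemma cvg_map_seq (X Y : topologicalType) (f : X -> Y) (u : nat -> X) (x : X) :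
  continuous f -> u @ \oo --> x -> (fun n => f (u n)) @ \oo --> f x.
Proof. by move=> cf ux; exact: (cvg_comp _ _ ux (cf x)). Qed.

Definition to_cts (X Y : topologicalType) (f : X -> Y) (cf : continuous f) :
  continuousType X Y := mkcts cf.

Lemma sequential_continuous (X Y : topologicalType) (f : X -> Y) :
  sequential X ->
  (forall u x, u @ \oo --> x -> (fun n => f (u n)) @ \oo --> f x) ->
  continuous f.
Proof.
move=> sX cf; apply/continuousP => A oA; apply: sX => u x Ax ux.
have /cvg_seqP H := cf u x ux; exact: H A oA Ax.
Qed.

Lemma clopen_fiber (X : topologicalType) (f : X -> nat) (m : nat) :
  continuous f -> clopen [set x | f x = m].
Proof.
apply: (preimage_clopen (A := [set m])).
by split; [exact: discrete_open|exact: discrete_closed].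
Qed.

Lemma clopen_agree (X : topologicalType) (f : nat -> X -> nat) (m : nat -> nat)
    (N : nat) :
  (forall i, continuous (f i)) ->
  clopen [set x | forall i, i < N -> f i x = m i].
Proof.
move=> cf; elim: N => [|N IH].
  rewrite (_ : [set x | _] = setT); first exact: clopenT.
  by apply/seteqP; split.
rewrite (_ : [set x | _] = [set x | forall i, i < N -> f i x = m i] `&`
  [set x | f N x = m N]); first by apply: clopenI => //; exact: clopen_fiber.
apply/seteqP; split=> [x xP|x [x1 x2] i].
  by split; [move=> i iN; apply: xP; exact: ltnW|exact: xP].
by rewrite ltnS leq_eqVlt => /orP[/eqP ->|]//; exact: x1.
Qed.

Lemma open_sequentialization (T : topologicalType) (U : set T) :
  open (U : set (sequentialization T)) = seq_open U.
Proof. by []. Qed.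

(** Open sets are sequentially open, and sequentially open sets capture the sequences of [T]
    converging into them, so no convergent sequence is lost or added. *)
Lemma cvg_sequentialization (T : topologicalType) (u : nat -> T) (x : T) :
  (u : nat -> sequentialization T) @ \oo --> (x : sequentialization T) <->
  u @ \oo --> x.
Proof.
split=> [/(@cvg_seqP (sequentialization T)) ux|ux].
  apply/cvg_seqP => U oU Ux; apply: ux; last exact: Ux.
  rewrite open_sequentialization => v y Uy vy.
  by have /cvg_seqP H := vy; exact: H.
apply/(@cvg_seqP (sequentialization T)) => U.
by rewrite open_sequentialization => oU Ux; exact: oU Ux ux.
Qed.

Lemma sequentialization_sequential (T : topologicalType) :
  sequential (sequentialization T).
Proof.
move=> U sU; rewrite open_sequentialization => u x Ux ux.
by apply: sU Ux _; apply/cvg_sequentialization.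
Qed.

(** If [U] were not a neighborhood of [z], finite intersections of an enumerated base at [z] would
    yield a sequence outside [U] converging to [z]. *)
Lemma second_countable_sequential (Z : topologicalType) :
  @second_countable Z -> sequential Z.
Proof.
move=> [B cB [oB bB]] U sU; apply: contrapT => noU.
have [z Uz nU] : exists2 z, U z & ~ nbhs z U.
  apply: contrapT => H; apply: noU; rewrite openE => z Uz.
  by apply: contrapT => nz; apply: H; exists z.
pose Bz := [set V | B V /\ V z].
have cBz : countable Bz by apply: sub_countable cB; apply: subset_card_le => V [].
have [f fP] : exists f : nat -> set Z, forall V, Bz V -> exists n, f n = V.
  have /countable_injP[g ginj] := cBz.
  have /choice[f fP] : forall n, exists V, (exists2 V', Bz V' & g V' = n) ->
      Bz V /\ g V = n.
    move=> n; have [[V BV gV]|nV] := pselect (exists2 V, Bz V & g V = n).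
      by exists V.
    by exists set0.
  exists f => V BV; exists (g V); have [] := fP (g V); first by exists V.
  by move=> BfV gfV; apply: ginj; rewrite ?inE.
(* Values of [f] at numbers coding no member of [Bz] are arbitrary; the guards keep only open
   neighborhoods of [z]. *)
pose W N := [set y | forall i, i < N -> f i z -> open (f i) -> f i y].
have oW N : nbhs z (W N).
  elim: N => [|N IH]; first by apply: filterS (filterT) => y _ i.
  have H : nbhs z [set y | f N z -> open (f N) -> f N y].
    have [[h1 h2]|h] := pselect (f N z /\ open (f N)).
      by have := open_nbhs_nbhs (conj h2 h1); apply: filterS => y ? _ _.
    by apply: filterS filterT => y _ h1 h2; case: h.
  apply: filterS2 IH H => y Wy Hy i; rewrite ltnS leq_eqVlt => /orP[/eqP ->//|].
  exact: Wy.
have /choice[y yP] : forall N, exists y, W N y /\ ~ U y.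
  move=> N; apply: contrapT => H; apply: nU; apply: filterS (oW N) => y Wy.
  by apply: contrapT => nUy; apply: H; exists y.
have yz : y @ \oo --> z.
  apply/cvg_seqP => V oV Vz.
  have := bB z V (open_nbhs_nbhs (conj oV Vz)) => -[V' [BV' V'z] V'V].
  have [n fn] := fP V' (conj BV' V'z).
  exists n.+1 => // m /= nm; apply: V'V => /=; rewrite -fn.
  by have [+ _] := yP m; apply=> //; rewrite fn //; exact: oB.
have [n _ /(_ n (leqnn n))] := sU y z Uz yz.
by have [] := yP n.
Qed.

Lemma quotient_sequential (Z X : topologicalType) (q : Z -> X) :
  sequential Z -> quotient_map q -> sequential X.
Proof.
move=> sZ [_ qo] U sU; apply/qo; apply: sZ => u z Uz uz.
apply: (sU (fun n => q (u n)) (q z)) => //; apply: cvg_map_seq uz.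
by apply/continuousP => A /qo.
Qed.

Lemma qcb0_sequential (X : topologicalType) : qcb0 X -> sequential X.
Proof.
by move=> [_ [Z [q [/second_countable_sequential sZ]]]]; exact: quotient_sequential.
Qed.

(** The fibers of [q] are open and disjoint, so choosing a nonempty basic open set inside each one
    is injective. *)
Lemma qcb0_discrete_countable (X : topologicalType) :
  qcb0 X -> (forall x : X, open [set x]) ->
  exists g : X -> nat, injective g.
Proof.
move=> [_ [Z [q [[B cB [oB bB]] [qsurj qo]]]]] dX.
have /choice[V VP] : forall x : X, exists V,
    [/\ B V, V !=set0 & V `<=` q @^-1` [set x]].
  move=> x; have [z qz] := qsurj x.
  have oq : open (q @^-1` [set x]) by apply/qo.
  have := bB z _ (open_nbhs_nbhs (conj oq qz)) => -[V [BV Vz] Vx].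
  by exists V; split => //; exists z.
have /countable_injP[g ginj] := cB.
exists (g \o V) => x y /= gxy; have [BVx [z Vxz] Vx] := VP x; have [BVy _ Vy] := VP y.
have eV : V x = V y by apply: ginj; rewrite ?inE.
by rewrite -(Vx _ Vxz); apply: Vy; rewrite -eV.
Qed.

(** * Countable cs-networks and quotients of countably based spaces *)

Section Network.
Variables (X : topologicalType) (B : nat -> set X).

(* A countable cs-network. *)
Definition pseudobase : Prop := forall u x U, open U -> U x -> u @ \oo --> x ->
  exists i, [/\ B i x, B i `<=` U & \forall n \near \oo, B i (u n)].

Definition network_at (xA : X * set nat) : Prop :=
  (forall i, xA.2 i -> B i xA.1) /\
  (forall U, open U -> U xA.1 -> exists2 i, xA.2 i & B i `<=` U).

(* The total space of the standard admissible representation: a point together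
   with enough positive information to determine its neighborhoods. *)
Definition network_space : Type := {xA : X * set nat | network_at xA}.

HB.instance Definition _ := gen_eqMixin network_space.
HB.instance Definition _ := gen_choiceMixin network_space.
HB.instance Definition _ := isSubBaseTopological.Build network_space
  [set: nat] (fun i => [set z : network_space | (sval z).2 i]).

Lemma network_space_second_countable : @second_countable network_space.
Proof.
exists (finI_from [set: nat] (fun i => [set z : network_space | (sval z).2 i])).
  apply: finI_from_countable; exact: countableP.
split.
  by move=> V FV; exists [set V]; [move=> ? ->|rewrite bigcup_set1].
move=> z A; rewrite nbhsE => -[V [[D sD <-]] [W DW Wz] VA].
exists W; first by split => //; exact: sD.
by move=> y Wy; apply: VA; exists W.
Qed.

Lemma network_space_cvg (u : nat -> network_space) (z : network_space) :
  (forall i, (sval z).2 i -> \forall n \near \oo, (sval (u n)).2 i) ->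
  u @ \oo --> z.
Proof.
move=> H; apply/cvg_seqP => V [D sD <-] [W DW Wz].
have [I sI eW] := sD _ DW.
suff : \forall n \near \oo, W (u n) by apply: filterS => n Wn; exists W.
rewrite -eW; rewrite -eW in Wz.
apply: (@filter_bigI _ _ _ _ (u @ \oo)) => i iI.
exact: H (Wz i iI).
Qed.

Lemma pseudobase_quotient : sequential X -> pseudobase ->
  exists (Z : topologicalType) (q : Z -> X), @second_countable Z /\ quotient_map q.
Proof.
move=> sX pB.
exists network_space, (fun z => (sval z).1); split.
  exact: network_space_second_countable.
have Bu x : network_at (x, [set i | B i x]).
  split=> //= U oU Ux.
  by have [i [Bi BU _]] := pB _ _ U oU Ux (cvg_cst x); exists i.
split=> [x|U]; first by exists (exist _ _ (Bu x)).
split=> [oU|oqU].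
  rewrite openE => z Uz; have [_ /(_ U oU Uz) [i zi iU]] := svalP z.
  rewrite /interior nbhsE; exists [set z : network_space | (sval z).2 i] => //.
    split => //.
    exists [set [set z : network_space | (sval z).2 i]];
      last by rewrite bigcup_set1.
    move=> _ ->; exists (fset1 i) => //; first by move=> j _; exact/mem_set.
    by rewrite set_fset1 bigcap_set1.
  move=> w wi; apply: iU; have [+ _] := svalP w; exact.
apply: sX => u x Ux ux.
(* Keeping only the sets that eventually contain [u] makes the lifted sequence converge to this lift
   of [x]; that they still form a network at [x] is the cs-property. *)
have Nx : network_at (x, [set i | B i x /\ \forall n \near \oo, B i (u n)]).
  split=> [i []//|V oV Vx].
  by have [i [Bi BV Bn]] := pB _ _ V oV Vx ux; exists i.
have /cvg_seqP : (fun n => exist network_at _ (Bu (u n)) : network_space) @ \oo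
    --> (exist network_at _ Nx : network_space).
  by apply: network_space_cvg => i [].
by move=> /(_ _ oqU Ux).
Qed.

End Network.

(** * Exponentials with discrete codomain *)

(* [phi] need not be injective, whence the shape of the conclusion. *)
Lemma fill_subseq (X : topologicalType) (y_ : nat -> X) (y : X) (phi : nat -> nat) :
  (forall n, n <= phi n) -> y_ @ \oo --> y ->
  exists y' : nat -> X, y' @ \oo --> y /\
    forall n, exists n', phi n' = phi n /\ y' (phi n) = y_ n'.
Proof.
move=> le_phi yy.
have /choice[y' y'P] : forall m, exists v, (exists2 n, phi n = m & v = y_ n) \/
    ((forall n, phi n <> m) /\ v = y).
  move=> m; have [[n nm]|nm] := pselect (exists n, phi n = m).
    by exists (y_ n); left; exists n.
  by exists y; right; split=> // n nm'; apply: nm; exists n.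
exists y'; split; last first.
  by move=> n; have [[n' e ->]|[/(_ n)//]] := y'P (phi n); exists n'.
apply/cvg_seqP => U oU Uy; have /cvg_seqP /(_ U oU Uy) [N _ NU] := yy.
(* An index [m >= M] in the range of [phi] can only be [phi n] with [n >= N]. *)
have [M HM] : exists M, forall n, n < N -> phi n < M.
  elim: (N) => [|K [M HM]]; first by exists 0.
  exists (maxn M (phi K).+1) => n; rewrite ltnS leq_eqVlt leq_max.
  by move=> /orP[/eqP ->|/HM ->//]; rewrite leqnn orbT.
exists M => // m /= Mm; have [[n nm ->]|[_ -> //]] := y'P m.
apply: NU => /=; rewrite leqNgt; apply/negP => /HM.
by rewrite nm ltnNge Mm.
Qed.

(** Otherwise there are bad pairs [(n, k)] with both entries arbitrarily large; [fill_subseq] places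
    the points [y_ k] at the positions [n] of a single sequence converging to [y], against the
    hypothesis. *)
Lemma continuous_cvg_joint (Y : topologicalType) (F : nat -> Y -> nat)
    (y : Y) (m : nat) :
  (forall y_, y_ @ \oo --> y -> \forall n \near \oo, F n (y_ n) = m) ->
  forall y_, y_ @ \oo --> y ->
  exists N, forall n k, N <= n -> N <= k -> F n (y_ k) = m.
Proof.
move=> HF y_ yy; apply: contrapT => H.
have /choice[phi phiP] : forall J, exists nk : nat * nat,
    [/\ J <= nk.1, J <= nk.2 & F nk.1 (y_ nk.2) <> m].
  move=> J; apply: contrapT => HJ; apply: H; exists J => n k Jn Jk.
  by apply: contrapT => ne; apply: HJ; exists (n, k).
have le1 n : n <= (phi n).1 by have [] := phiP n.
have le2 n : n <= (phi n).2 by have [] := phiP n.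
have [y' [y'y y'P]] := fill_subseq le1 (cvg_subseq le2 yy).
have [N _ /(_ N (leqnn N))/=] := near_subseq le1 (HF _ y'y).
by have [n [<- ->]] := y'P N; have [] := phiP n.
Qed.

(* Up to homeomorphism [E] is the exponential [Z^Y] of sequential spaces: by
   [exp_ev] and [exp_cvg] convergence in [E] is continuous convergence. *)
Record exp_spec (E Y Z : topologicalType) (ev : E -> Y -> Z) : Prop := ExpSpec {
  exp_ev : forall e_ e y_ y, e_ @ \oo --> e -> y_ @ \oo --> y ->
    (fun n => ev (e_ n) (y_ n)) @ \oo --> ev e y;
  exp_inj : forall e e', ev e =1 ev e' -> e = e';
  exp_fun : forall f : Y -> Z, continuous f -> exists e, ev e =1 f;
  exp_cvg : forall e_ e,
    (forall y_ y, y_ @ \oo --> y ->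
       (fun n => ev (e_ n) (y_ n)) @ \oo --> ev e y) ->
    e_ @ \oo --> e }.

Lemma exp_continuous (E Y Z : topologicalType) (ev : E -> Y -> Z) (e : E) :
  sequential Y -> exp_spec ev -> continuous (ev e).
Proof.
move=> sY X; apply: sequential_continuous => // u y uy.
by apply: (exp_ev X (e_ := fun=> e)) uy; exact: cvg_cst.
Qed.

Lemma exp_continuous_at (E Y Z : topologicalType) (ev : E -> Y -> Z) (y : Y) :
  sequential E -> exp_spec ev -> continuous (ev ^~ y).
Proof.
move=> sE X; apply: sequential_continuous => // u e ue.
by apply: (exp_ev X (y_ := fun=> y)) ue _; exact: cvg_cst.
Qed.

(** Along a sequence converging into this set, [continuous_cvg_joint] handles all large [n] at once,
    and finitely many continuous functions remain. *)
Lemma open_eventually_const (E Y : topologicalType) (ev : E -> Y -> nat)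
    (e_ : nat -> E) (e : E) (N m : nat) :
  sequential Y -> exp_spec ev -> e_ @ \oo --> e ->
  open [set y | ev e y = m /\ forall n, N <= n -> ev (e_ n) y = m].
Proof.
move=> sY X ee; apply: sY => z_ z [ez eNz] zz.
have ez_ e' : \forall j \near \oo, ev e' (z_ j) = ev e' z.
  by apply/cvg_natP; apply: (exp_ev X (e_ := fun=> e')) zz; exact: cvg_cst.
have [|J HJ] := continuous_cvg_joint (F := fun n => ev (e_ n)) (m := m) _ zz.
  by move=> y_ yz; apply/cvg_natP; rewrite -ez; exact: (exp_ev X).
have HnJ : \forall j \near \oo, forall n, N <= n -> n < J -> ev (e_ n) (z_ j) = m.
  elim: (J) => [|K IH]; first by apply: filterS filterT => j _ n.
  apply: filterS2 IH (ez_ (e_ K)) => j Hj HK n Nn.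
  rewrite ltnS leq_eqVlt => /orP[/eqP nK|]; last exact: Hj.
  by rewrite nK HK -nK; exact: eNz.
have HJ' : \forall j \near \oo, J <= j by exists J.
apply: filterS3 (ez_ e) HnJ HJ' => j ej Hj Jj; split; first by rewrite ej.
by move=> n Nn; have [Jn|nJ] := leqP J n; [exact: HJ|exact: Hj].
Qed.

Definition has_pseudobase (X : topologicalType) : Prop :=
  exists B : nat -> set X, pseudobase B.

(** If no finite intersection of good conditions fitted inside [U], choosing points outside [U] that
    satisfy more and more of them would give a sequence converging continuously to [e]. *)
Lemma exp_pseudobase (E Y : topologicalType) (ev : E -> Y -> nat) :
  sequential Y -> exp_spec ev -> has_pseudobase Y -> has_pseudobase E.
Proof.
move=> sY X [B pB].
pose sat (c : nat * nat) : set E := [set e | forall y, B c.1 y -> ev e y = c.2].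
pose sats (s : seq (nat * nat)) : set E := [set e | forall c, c \in s -> sat c e].
exists (fun k => if (choice.unpickle k : option (seq (nat * nat))) is Some s
  then sats s else setT).
move=> u e U oU Ue ue; apply: contrapT => H.
pose good c := sat c e /\ \forall n \near \oo, sat c (u n).
(* The good pairs decoded from numbers below [k]; every good pair is eventually listed. *)
pose s k := [seq c <- pmap (@choice.unpickle (nat * nat)%type) (iota 0 k) | `[< good c >]].
have /choice[g gP] : forall k, exists g, sats (s k) g /\ ~ U g.
  move=> k; apply: contrapT => Hk; apply: H; exists (choice.pickle (s k)).
  rewrite choice.pickleK; split.
  - by move=> c; rewrite mem_filter => /andP[/asboolP[]].
  - by move=> f sf; apply: contrapT => nUf; apply: Hk; exists f.
  - have : forall c, c \in s k -> good c.
      by move=> c; rewrite mem_filter => /andP[/asboolP].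
    elim: (s k) => [_|c t IH Ht]; first by apply: filterS filterT => n _ c.
    have [_ cn] := Ht c (mem_head _ _).
    have {}IH := IH (fun d dt => Ht d (mem_behead (s := c :: t) dt)).
    apply: filterS2 cn IH.
    by move=> n cn tn d; rewrite inE => /orP[/eqP ->//|]; exact: tn.
have ge : g @ \oo --> e.
  apply: (exp_cvg X) => z_ y zy.
  pose m := ev e y.
  have : (fun n => ev (u n) y) @ \oo --> m.
    by apply: (exp_ev X (y_ := fun=> y)) ue _; exact: cvg_cst.
  move=> /cvg_natP[N _ HN].
  have oV := open_eventually_const N m sY X ue.
  have [|i [Biy BiV Biz]] := pB _ _ _ oV _ zy; first by split.
  have gim : good (i, m).
    split; first by move=> x /BiV [].
    by exists N => // n Nn x /BiV[_]; exact.
  have Hi : \forall n \near \oo, choice.pickle (i, m) < n.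
    by exists (choice.pickle (i, m)).+1.
  apply/cvg_natP; apply: filterS2 Biz Hi => n Bzn ltn.
  have [sg _] := gP n; apply: (sg (i, m)) => //.
  rewrite mem_filter; apply/andP; split; first exact/asboolP.
  rewrite mem_pmap; apply/mapP; exists (choice.pickle (i, m));
    last by rewrite choice.pickleK.
  by rewrite mem_iota.
have /cvg_seqP /(_ U oU Ue) [N _ /(_ N (leqnn N))] := ge.
by have [] := gP N.
Qed.

Definition seq_compact (X : topologicalType) : Prop :=
  forall (K : set X) (x_ : nat -> X), compact K -> (forall n, K (x_ n)) ->
  exists (phi : nat -> nat) (x : X),
    [/\ forall n, n <= phi n, K x & (fun n => x_ (phi n)) @ \oo --> x].

(** [d] picks a point in each nonempty [B i]. Some [B i] contains [y] and lies where both functions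
    keep their value at [y]. *)
Lemma exp_dense (E Y : topologicalType) (ev : E -> Y -> nat) (y0 : Y) :
  sequential Y -> exp_spec ev -> has_pseudobase Y ->
  exists d : nat -> Y,
    forall e e', (forall i, ev e (d i) = ev e' (d i)) -> e = e'.
Proof.
move=> sY X [B pB].
have /choice[d dP] : forall i, exists y, B i !=set0 -> B i y.
  move=> i; have [[y By]|nB] := pselect (B i !=set0); first by exists y.
  by exists y0.
exists d => e e' ed; apply: (exp_inj X) => y.
have [oU _] := clopen_fiber (ev e y) (exp_continuous (e := e) sY X).
have [oV _] := clopen_fiber (ev e' y) (exp_continuous (e := e') sY X).
have [|i [Bi BU _]] := pB _ _ _ (openI oU oV) _ (cvg_cst y); first by split.
have /BU[<- <-] : B i (d i) by apply: dP; exists y.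
exact: ed.
Qed.

(** Take a cluster point [x] and a subsequence agreeing with it on longer and longer parts of the
    dense sequence [d]. Any cluster point of a further subsequence agrees with [x] on all of [d],
    hence equals [x]. *)
Lemma exp_seq_compact (E Y : topologicalType) (ev : E -> Y -> nat) (y0 : Y) :
  sequential E -> sequential Y -> exp_spec ev -> has_pseudobase Y ->
  seq_compact E.
Proof.
move=> sE sY X pY K x_ cK Kx.
have [d dP] := exp_dense y0 sY X pY.
have cluster_seq (u : nat -> E) : (forall n, K (u n)) -> exists2 x, K x &
    forall U, open U -> U x -> forall N, exists2 n, N <= n & U (u n).
  move=> Ku; have [|x [Kx' clx]] := cK (u @ \oo) _.
    by exists 0 => // n _; exact: Ku.
  exists x => // U oU Ux N.
  have [_ [[n Nn <-] Un]] : [set u n | n in [set n | N <= n]] `&` U !=set0.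
    apply: clx; last exact: open_nbhs_nbhs.
    by exists N => // n Nn; exists n.
  by exists n.
have oV x N : open [set z | forall i, i < N -> ev z (d i) = ev x (d i)].
  have [] // := clopen_agree (fun i => ev x (d i)) N
    (fun i => exp_continuous_at (y := d i) sE X).
have [x Kx' clx] := cluster_seq x_ Kx.
have /choice[phi phiP] : forall N, exists n, N <= n /\
    forall i, i < N -> ev (x_ n) (d i) = ev x (d i).
  by move=> N; have [n Nn Hn] := clx _ (oV x N) (fun _ _ => erefl) N; exists n.
exists phi, x; split=> //; first by move=> n; have [] := phiP n.
apply/cvg_seqP => U oU Ux; apply: contrapT => /not_near_ooP[psi le_psi nU].
have [x' _ clx'] := cluster_seq (fun n => x_ (phi (psi n))) (fun n => Kx _).
have [Ux'|nUx'] := pselect (U x').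
  by have [n _ /nU] := clx' U oU Ux' 0.
apply: nUx'; suff -> : x' = x by [].
apply: dP => i.
have [n ni Hn] := clx' _ (oV x' i.+1) (fun _ _ => erefl) i.+1.
rewrite -Hn //; have [_ ->//] := phiP (psi n).
exact: leq_trans ni (le_psi n).
Qed.

(** A filter not clustering at [x] avoids a neighborhood of [x], hence contains a finite set of
    terms. *)
Lemma compact_cvg_tail (X : topologicalType) (u : nat -> X) (x : X) (N : nat) :
  u @ \oo --> x -> compact [set z | z = x \/ exists2 n, N <= n & z = u n].
Proof.
move=> ux F FF FK; apply: contrapT => H.
have /existsNP[A /existsNP[V /not_implyP[FA /not_implyP[xV AV]]]] :
    ~ cluster F x by move=> cx; apply: H; exists x; split; [left|].
have [M _ MV] := ux V xV.
pose G := [set u n | n in [set n | n < M]].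
have FG : F G.
  apply: filterS (filterI FA FK) => z [Az [zx|[n Nn zn]]].
    by exfalso; apply: AV; exists z; split => //; rewrite zx; exact: nbhs_singleton.
  exists n => //=; rewrite ltnNge; apply/negP => Mn.
  by apply: AV; exists z; split => //; rewrite zn; exact: (MV n).
have cG : compact (G `&` [set z | z = x \/ exists2 n, N <= n & z = u n]).
  apply: finite_compact; apply: sub_finite_set (@subIsetl _ _ _) _.
  by apply: finite_image; exact: finite_II.
have [z [[_ Kz] cz]] := cG F FF (filterI FG FK).
by apply: H; exists z.
Qed.

Lemma cvg_compact_open_space (X Y : topologicalType)
    (e_ : nat -> compact_open_space X Y) (e : compact_open_space X Y) :
  e_ @ \oo --> e <->
  forall (K : set X) (O : set Y), compact K -> open O ->
    (e : continuousType X Y) @` K `<=` O ->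
    \forall n \near \oo, (e_ n : continuousType X Y) @` K `<=` O.
Proof.
pose emb (f : compact_open_space X Y) : {compact-open, X -> Y} :=
  (f : continuousType X Y).
have H : e_ @ \oo --> e <-> (fun n => emb (e_ n)) @ \oo --> emb e.
  split=> ee.
    apply: (cvg_comp e_ emb ee).
    exact: (@initial_continuous _ _ emb e).
  apply/cvg_seqP => _ [V oV <-] Ve.
  by have /cvg_seqP K := ee; exact: K.
apply: (iff_trans H); apply: compact_open_cvgP.
Qed.

(** Compact-open convergence is continuous because a convergent sequence with its limit is compact.
    Conversely, points of [K] sent outside [O] have a convergent subsequence, which refutes
    continuous convergence. *)
Lemma qcb_exp_spec (X : topologicalType) : sequential X -> seq_compact X ->
  exp_spec (fun (e : qcb_exp nat X) (x : X) => (e : continuousType X nat) x).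
Proof.
move=> sX cX; split.
- move=> e_ e y_ y /cvg_sequentialization /cvg_compact_open_space ee yy.
  set f := (e : continuousType X nat).
  have [N _ HN] : \forall n \near \oo, f (y_ n) = f y.
    by apply/cvg_natP; apply: cvg_map_seq yy; exact: cts_fun.
  have HK := ee _ [set f y] (compact_cvg_tail (N := N) yy) (discrete_open _).
  have {}HK := HK _; apply/cvg_natP.
  have {}HK : \forall n \near \oo, (e_ n : continuousType X nat)
      @` [set z | z = y \/ exists2 n, N <= n & z = y_ n] `<=` [set f y].
    by apply: HK => _ [z [->|[n Nn ->]] <- //]; exact: (HN n).
  have HN' : \forall n \near \oo, N <= n by exists N.
  apply: filterS2 HK HN' => n HK Nn; apply: HK.
  by exists (y_ n) => //; right; exists n.
- by move=> e e' ee'; apply/continuousEP.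
- by move=> f cf; exists (to_cts cf).
- move=> e_ e H; apply/cvg_sequentialization/cvg_compact_open_space => K O cK oO eKO.
  apply: contrapT => /not_near_ooP[phi le_phi Hphi].
  have /choice[z zP] : forall n, exists z,
      K z /\ ~ O ((e_ (phi n) : continuousType X nat) z).
    move=> n; apply: contrapT => Hn; apply: (Hphi n) => _ [z Kz <-].
    by apply: contrapT => nO; apply: Hn; exists z.
  have [psi [x [le_psi Kx zx]]] := cX K z cK (fun n => (zP n).1).
  have fz : continuous (e : continuousType X nat) by exact: cts_fun.
  have Oex : O ((e : continuousType X nat) x) by apply: eKO; exists x.
  have [y' [y'x y'P]] :=
    fill_subseq (fun n => leq_trans (le_psi n) (le_phi _)) zx.
  have /cvg_seqP/(_ O oO Oex) Hn := H _ _ y'x; move: Hn.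
  move=> /(near_subseq (fun n => leq_trans (le_psi n) (le_phi _))).
  move=> [M _ /(_ M (leqnn M))] /=.
  have [n [<- ->]] := y'P M.
  by have [_] := zP (psi n).
Qed.

(** * Products and exponentials of Kleene-Kreisel spaces *)

(** Joint continuity is phrased with sequences, so that currying requires no product of [W] and
    [Y]. *)
Lemma exp_curry (E Y Z W : topologicalType) (ev : E -> Y -> Z) (F : W -> Y -> Z) :
  sequential Y -> sequential W -> exp_spec ev ->
  (forall w_ w y_ y, w_ @ \oo --> w -> y_ @ \oo --> y ->
    (fun n => F (w_ n) (y_ n)) @ \oo --> F w y) ->
  exists2 h : W -> E, continuous h & forall w y, ev (h w) y = F w y.
Proof.
move=> sY sW X cF.
have /choice[h hP] : forall w, exists e, ev e =1 F w.
  move=> w; apply: (exp_fun X); apply: sequential_continuous => // u y uy.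
  by apply: (cF (fun=> w)) uy; exact: cvg_cst.
exists h => //; apply: sequential_continuous => // w_ w ww.
apply: (exp_cvg X) => y_ y yy; rewrite hP.
by under eq_fun do rewrite hP; exact: cF.
Qed.

Lemma exp_map (E E' Y Y' Z : topologicalType) (ev : E -> Y -> Z)
    (ev' : E' -> Y' -> Z) (f : Y' -> Y) :
  sequential E -> sequential Y' -> exp_spec ev -> exp_spec ev' ->
  continuous f ->
  exists2 h : E -> E', continuous h & forall e y, ev' (h e) y = ev e (f y).
Proof.
move=> sE sY' X X' cf.
apply: (exp_curry (F := fun e y => ev e (f y)) sY' sE X') => e_ e y_ y ee yy.
by apply: (exp_ev X) => //; exact: cvg_map_seq yy.
Qed.

Lemma exp_homeomorphic (E E' Y Y' Z : topologicalType) (ev : E -> Y -> Z)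
    (ev' : E' -> Y' -> Z) :
  sequential E -> sequential E' -> sequential Y -> sequential Y' ->
  exp_spec ev -> exp_spec ev' -> homeomorphic Y Y' -> homeomorphic E E'.
Proof.
move=> sE sE' sY sY' X X' [f [g [fK gK]]].
have cf : continuous f by exact: cts_fun.
have cg : continuous g by exact: cts_fun.
have [h ch hP] := exp_map sE sY' X X' cg.
have [h' ch' hP'] := exp_map sE' sY X' X cf.
exists (to_cts ch), (to_cts ch').
split=> [e|e].
  by apply: (exp_inj X) => y; rewrite hP' hP fK.
by apply: (exp_inj X') => y; rewrite hP hP' gK.
Qed.

(** * Binary products and absorption of a factor *)

Record prod_spec (P X Y : topologicalType) (p : P -> X) (q : P -> Y) : Prop :=
  ProdSpec {
  prod_fst : continuous p;
  prod_snd : continuous q;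
  prod_inj : forall w w', p w = p w' -> q w = q w' -> w = w';
  prod_pair : forall x y, exists2 w, p w = x & q w = y;
  prod_cvg : forall w_ w, (fun n => p (w_ n)) @ \oo --> p w ->
    (fun n => q (w_ n)) @ \oo --> q w -> w_ @ \oo --> w }.

Lemma prod_spec_sym (P X Y : topologicalType) (p : P -> X) (q : P -> Y) :
  prod_spec p q -> prod_spec q p.
Proof.
case=> cp cq inj pair cvg; split=> //.
- by move=> w w' ? ?; exact: inj.
- by move=> y x; have [w] := pair x y; exists w.
- by move=> w_ w ? ?; exact: cvg.
Qed.

Lemma nat_pairing : exists (c : nat * nat -> nat) (d : nat -> nat * nat),
  cancel c d /\ cancel d c.
Proof.
have /card_set_bijP[c] := card_nat2.
by rewrite setTT_bijective => -[d cK dK]; exists c, d.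
Qed.

(** A transposition is an involution, so [exp_prod_retract] encodes and decodes values by the same
    formula. *)
Definition swap (v w x : nat) : nat :=
  if x == v then w else if x == w then v else x.

Lemma swapl v w : swap v w v = w.
Proof. by rewrite /swap eqxx. Qed.

Lemma swapC v w : swap v w =1 swap w v.
Proof. by move=> x; rewrite /swap; case: eqP => [->|]; case: eqP => [->|]. Qed.

Lemma swapK v w : involutive (swap v w).
Proof.
move=> x; rewrite {2}/swap; case: eqP => [->|xv]; first by rewrite swapC swapl.
case: eqP => [->|xw]; first by rewrite swapl.
by rewrite /swap; case: eqP => //; case: eqP.
Qed.

Lemma exp_prod_retract (A B EA EB : topologicalType) (evA : EA -> A -> nat)
    (evB : EB -> B -> nat) (s : B -> A) (r : A -> B) :
  sequential A -> sequential B -> sequential EA ->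
  exp_spec evA -> exp_spec evB -> continuous s -> continuous r -> cancel s r ->
  exists (p : EA -> EB) (q : EA -> EA), prod_spec p q.
Proof.
move=> sA sB sEA XA XB cs cr sK.
have [c [d [cK dK]]] := nat_pairing.
(* The inverse of [(p, q)] sends [(u, f)] to the functional
   [a |-> swap (c (u (r a), f (s (r a)))) (f (s (r a))) (f a)], whose restriction
   along [s] is [b |-> c (u b, f (s b))]. *)
have evN e_ e a_ a : e_ @ \oo --> e -> a_ @ \oo --> a ->
    \forall n \near \oo, evA (e_ n) (a_ n) = evA e a.
  by move=> ee aa; apply/cvg_natP; exact: (exp_ev XA).
have evNB e_ e b_ b : e_ @ \oo --> e -> b_ @ \oo --> b ->
    \forall n \near \oo, evB (e_ n) (b_ n) = evB e b.
  by move=> ee aa; apply/cvg_natP; exact: (exp_ev XB).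
have csr a_ a : a_ @ \oo --> a -> (fun n => s (r (a_ n))) @ \oo --> s (r a).
  by move=> aa; exact: cvg_map_seq cs (cvg_map_seq cr aa).
have [|p cp pE] := exp_curry (F := fun g b => (d (evA g (s b))).1) sB sEA XB.
  move=> e_ e b_ b ee bb; apply/cvg_natP.
  by apply: filterS (evN _ _ _ _ ee (cvg_map_seq cs bb)) => n ->.
have [|q cq qE] := exp_curry (F := fun g a =>
    swap (evA g (s (r a))) (d (evA g (s (r a)))).2 (evA g a)) sA sEA XA.
  move=> e_ e a_ a ee aa; apply/cvg_natP.
  by apply: filterS2 (evN _ _ _ _ ee aa) (evN _ _ _ _ ee (csr _ _ aa)) => n -> ->.
have qs g b : evA (q g) (s b) = (d (evA g (s b))).2 by rewrite qE sK swapl.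
have cpq g b : evA g (s b) = c (evB (p g) b, evA (q g) (s b)).
  by rewrite qs pE -surjective_pairing dK.
(* At each [a] the same involution leads from [g] to [q g] and back; its two parameters are
   recovered from [p g] and [q g]. *)
have gE g a : evA g a = swap (c (evB (p g) (r a), evA (q g) (s (r a))))
    (evA (q g) (s (r a))) (evA (q g) a).
  by rewrite -cpq qs (qE g a) swapK.
exists p, q; split=> //.
- by move=> g g' pp qq; apply: (exp_inj XA) => a; rewrite gE pp qq -gE.
- move=> u f.
  have [|g gP] := exp_fun XA (f := fun a =>
      swap (c (evB u (r a), evA f (s (r a)))) (evA f (s (r a))) (evA f a)).
    apply: sequential_continuous => // a_ a aa; apply/cvg_natP.
    apply: filterS3 (evN _ _ _ _ (cvg_cst f) aa)
      (evN _ _ _ _ (cvg_cst f) (csr _ _ aa))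
      (evNB _ _ _ _ (cvg_cst u) (cvg_map_seq cr aa)) => n /= -> -> -> //.
  have gs b : evA g (s b) = c (evB u b, evA f (s b)).
    by rewrite gP sK swapC swapl.
  exists g; first by apply: (exp_inj XB) => b; rewrite pE gs cK.
  by apply: (exp_inj XA) => a; rewrite qE gs cK gP /= swapK.
- move=> g_ g pg qg; apply: (exp_cvg XA) => a_ a aa; apply/cvg_natP.
  apply: filterS3 (evN _ _ _ _ qg aa) (evN _ _ _ _ qg (csr _ _ aa))
    (evNB _ _ _ _ pg (cvg_map_seq cr aa)) => n h1 h2 h3.
  by rewrite gE h1 h2 h3 -gE.
Qed.

(* Starting at [one_space] makes [nat], up to homeomorphism the power [nat^1], a
   level like the others. *)
Definition level (k : nat) : topologicalType :=
  if k is k'.+1 then kleene_kreisel k' else one_space.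

Lemma one_spaceE (x y : one_space) : x = y.
Proof. by case: x; case: y. Qed.

Lemma cvg_one_space (T : Type) (F : set_system T) (f : T -> one_space) (x : one_space) :
  Filter F -> f @ F --> x.
Proof.
move=> FF A /nbhs_singleton Ax; suff -> : A = setT by exact: filterT.
by apply/seteqP; split=> // y _; rewrite (one_spaceE y x).
Qed.

Lemma sequential_one_space : sequential one_space.
Proof. by move=> U _; exact: discrete_open. Qed.

Lemma sequential_level (k : nat) : sequential (level k).
Proof.
case: k => [|[|k]]; first exact: sequential_one_space.
  by move=> U _; exact: discrete_open.
exact: sequentialization_sequential.
Qed.

Lemma exp_one_spec (Z : topologicalType) : exp_spec (fun (z : Z) (_ : one_space) => z).
Proof.
split=> //.
- by move=> z z' /(_ tt).
- by move=> f _; exists (f tt) => -[].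
- by move=> z_ z /(_ (fun=> tt) tt); apply; exact: cvg_one_space.
Qed.

(** One induction carries all three: the exponential structure and the cs-network at [k] make
    [level k.+1] sequentially compact, as [qcb_exp_spec] requires for the next exponential. *)
Lemma level_spec (k : nat) : [/\ has_pseudobase (level k), inhabited (level k) &
  exists ev : level k.+1 -> level k -> nat, exp_spec ev].
Proof.
elim: k => [|k [pB [x0] [ev X]]].
  split; last by exists (fun n _ => n); exact: exp_one_spec.
  - exists (fun=> setT) => u x U _ Ux _; exists 0; split=> //.
      by move=> y _; rewrite (one_spaceE y x).
    exact: filterT.
  - by exists; exact: tt.
have sk := @sequential_level k; have sk1 := @sequential_level k.+1.
split.
- exact: exp_pseudobase sk X pB.
- have [e _] := exp_fun X (f := fun=> 0) (fun=> cvg_cst _).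
  by exists.
- exists (fun (e : qcb_exp nat (level k.+1)) x =>
    (e : continuousType (level k.+1) nat) x).
  exact: (qcb_exp_spec sk1 (exp_seq_compact x0 sk1 sk X pB)).
Qed.

Lemma exp_kolmogorov (E Y : topologicalType) (ev : E -> Y -> nat) :
  sequential E -> exp_spec ev -> kolmogorov_space E.
Proof.
move=> sE X e e' /eqP ee'.
have [y ney] : exists y, ev e y <> ev e' y.
  apply: contrapT => H; apply: ee'; apply: (exp_inj X) => y.
  by apply: contrapT => ney; apply: H; exists y.
have [oU _] := clopen_fiber (ev e y) (exp_continuous_at (y := y) sE X).
exists [set z | ev z y = ev e y]; left; split; apply/mem_set.
  exact: open_nbhs_nbhs.
exact/nesym.
Qed.

Lemma qcb0_level (k : nat) : qcb0 (level k).
Proof.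
have [[B pB] _ _] := level_spec k; split.
  case: k {pB B} => [|k]; last first.
    have [_ _ [ev X]] := level_spec k; exact: exp_kolmogorov (@sequential_level k.+1) X.
  by move=> x y; rewrite (one_spaceE x y) eqxx.
exact: pseudobase_quotient (@sequential_level k) pB.
Qed.

(** Precomposition with [r] and with [s] lifts a retraction one level, starting from the one-point
    [level 0]. *)
Lemma level_retract (i j : nat) : i <= j ->
  exists (s : level i -> level j) (r : level j -> level i),
    [/\ continuous s, continuous r & cancel s r].
Proof.
elim: i j => [|i IH] j.
  have [_ [x] _] := level_spec j => _.
  exists (fun=> x), (fun=> tt); split=> [||y]; last exact: one_spaceE.
    by move=> ?; exact: cvg_cst.
  by move=> ?; exact: cvg_cst.
case: j => // j /IH[s [r [cs cr sK]]].
have [_ _ [ev X]] := level_spec i; have [_ _ [ev' X']] := level_spec j.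
have sl k : sequential (level k) := @sequential_level k.
have [s' cs' s'E] := exp_map (sl _) (sl _) X X' cr.
have [r' cr' r'E] := exp_map (sl _) (sl _) X' X cs.
exists s', r'; split=> // e; apply: (exp_inj X) => x.
by rewrite r'E s'E sK.
Qed.

Lemma prod_one_spec (Y : topologicalType) (p : Y -> one_space) :
  prod_spec p (@idfun Y).
Proof.
split=> //.
- by move=> y; exact: cvg_one_space.
- by move=> y.
- by move=> x y; exists y => //; exact: one_spaceE.
Qed.

Lemma level_prod (i j : nat) :
  exists m (p : level m -> level i) (q : level m -> level j), prod_spec p q.
Proof.
have sl k : sequential (level k) := @sequential_level k.
wlog ij : i j / i <= j.
  move=> H; have [/H//|/ltnW/H[m [p [q /prod_spec_sym pq]]]] := leqP i j.
  by exists m, q, p.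
case: i ij => [_|i]; first by exists j, (fun=> tt), idfun; exact: prod_one_spec.
case: j => // j ij.
have [s [r [cs cr sK]]] := level_retract (i := i) (j := j) ij.
have [_ _ [ev X]] := level_spec i; have [_ _ [ev' X']] := level_spec j.
have [p [q pq]] := exp_prod_retract (sl _) (sl _) (sl _) X' X cs cr sK.
by exists j.+1, p, q.
Qed.

(** The exponential law: a power of nat^X by Y is nat to the product of X and Y, and that product is
    a level by [level_prod]. A one-point target is its own power. *)
Lemma level_exp (j i : nat) :
  exists m (ev : level m -> level j -> level i), exp_spec ev.
Proof.
have sl k : sequential (level k) := @sequential_level k.
case: i => [|i].
  exists 0, (fun _ _ => tt); split.
  - by move=> *; exact: cvg_one_space.
  - by move=> *; exact: one_spaceE.
  - by move=> f _; exists tt => y; exact: one_spaceE.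
  - by move=> *; exact: cvg_one_space.
have [m [a [b ab]]] := level_prod i j.
have [_ _ [eZ XZ]] := level_spec i; have [_ _ [eE XE]] := level_spec m.
have /choice[phi phiP] : forall xy : level i * level j,
    exists w, a w = xy.1 /\ b w = xy.2.
  by move=> [x y]; have [w] := prod_pair ab x y; exists w.
have cphi x_ x y_ y : x_ @ \oo --> x -> y_ @ \oo --> y ->
    (fun n => phi (x_ n, y_ n)) @ \oo --> phi (x, y).
  move=> xx yy; apply: (prod_cvg ab).
    by rewrite (phiP _).1; under eq_fun do rewrite (phiP _).1.
  by rewrite (phiP _).2; under eq_fun do rewrite (phiP _).2.
have phiK w : phi (a w, b w) = w.
  by apply: (prod_inj ab); rewrite ?(phiP _).1 ?(phiP _).2.
have /choice[ev evP] : forall ey : level m.+1 * level j,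
    exists z, forall x, eZ z x = eE ey.1 (phi (x, ey.2)).
  move=> [e y] /=; apply: (exp_fun XZ (f := fun x => eE e (phi (x, y)))).
  apply: sequential_continuous => // x_ x xx.
  apply: (exp_ev XE (e_ := fun=> e)); first exact: cvg_cst.
  by apply: cphi => //; exact: cvg_cst.
exists m.+1, (fun e y => ev (e, y)); split.
- move=> e_ e y_ y ee yy; apply: (exp_cvg XZ) => x_ x xx; rewrite evP.
  under eq_fun do rewrite evP.
  by apply: (exp_ev XE) => //; exact: cphi.
- move=> e e' ee'; apply: (exp_inj XE) => w.
  by rewrite -(phiK w) -(evP (e, b w)) -(evP (e', b w)) ee'.
- move=> f cf.
  have [|e eP] := exp_fun XE (f := fun w => eZ (f (b w)) (a w)).
    apply: sequential_continuous => // w_ w ww; apply: (exp_ev XZ).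
      by apply: cvg_map_seq cf _; exact: cvg_map_seq (prod_snd ab) ww.
    exact: cvg_map_seq (prod_fst ab) ww.
  exists e => y; apply: (exp_inj XZ) => x.
  by rewrite evP /= eP (phiP _).1 (phiP _).2.
- move=> e_ e H; apply: (exp_cvg XE) => w_ w ww.
  have eEE e' w' : eE e' w' = eZ (ev (e', b w')) (a w') by rewrite evP phiK.
  rewrite eEE; under eq_fun do rewrite eEE.
  apply: (exp_ev XZ); last exact: cvg_map_seq (prod_fst ab) ww.
  by apply: H; exact: cvg_map_seq (prod_snd ab) ww.
Qed.

(** * Cartesian closed subcategories *)

(* Equivalently, a continuous map from [A] to the one-point compactification of
   [nat] sending [a_ n] to [n] and [a] to infinity. *)
Definition test_sequence (A : topologicalType) (a_ : nat -> A) (a : A)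
    (D : nat -> set A) : Prop :=
  [/\ a_ @ \oo --> a, forall n, clopen (D n),
      forall n, D n (a_ n) & forall n m z, D n z -> D m z -> n = m].

Section TestSequence.
Variables (A : topologicalType) (a_ : nat -> A) (a : A) (D : nat -> set A).
Hypothesis test : test_sequence a_ a D.

Lemma test_limit n : ~ D n a.
Proof.
have [/cvg_seqP aa oD Da disj] := test => Dna.
have [N _ HN] := aa _ (oD n).1 Dna.
have e1 := disj _ _ _ (HN N (leqnn N)) (Da N).
have e2 := disj _ _ _ (HN N.+1 (leqnSn N)) (Da N.+1).
by move: e2; rewrite e1 => /eqP; rewrite ltn_eqF.
Qed.

Lemma test_near n z (z_ : nat -> A) : D n z -> z_ @ \oo --> z ->
  \forall k \near \oo, D n (z_ k).
Proof. by move=> Dz /cvg_seqP; apply=> //; have [_ /(_ n)[]] := test. Qed.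

Lemma test_far N z (z_ : nat -> A) : (forall n, ~ D n z) -> z_ @ \oo --> z ->
  \forall k \near \oo, forall n, D n (z_ k) -> N <= n.
Proof.
move=> nD zz; elim: N => [|N IH]; first by apply: filterS filterT => k _ n _.
have [_ /(_ N)[_ /closed_openC oN] _ _] := test.
have /cvg_seqP/(_ _ oN (nD N)) := zz.
apply: filterS2 IH => k Hk nDk n Dn; rewrite ltn_neqAle Hk // andbT.
by apply/eqP => Nn; apply: nDk; rewrite Nn.
Qed.

(** [V] is a bare type because it is instantiated both with a space and with the functions
    [Y -> nat]. *)
Lemma test_split (V : Type) (v_ : nat -> V) (v : V) : exists h : A -> V,
  (forall n z, D n z -> h z = v_ n) /\ (forall z, (forall n, ~ D n z) -> h z = v).
Proof.
have [_ _ _ disj] := test.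
have /choice[h hP] : forall z, exists w, (exists2 n, D n z & w = v_ n) \/
    (forall n, ~ D n z) /\ w = v.
  move=> z; have [[n Dn]|nD] := pselect (exists n, D n z).
    by exists (v_ n); left; exists n.
  by exists v; right; split=> // n Dn; apply: nD; exists n.
exists h; split=> [n z Dn|z nD]; have [[m Dm ->]|[H ->//]] := hP z.
- by rewrite (disj _ _ _ Dm Dn).
- by case: (H n Dn).
- by case: (nD m Dm).
Qed.

(** The map is constant on each open [D n]. Near a point outside all of them its values are [x] or,
    by [test_far], late terms of [x_]. *)
Lemma test_map (X : topologicalType) (x_ : nat -> X) (x : X) :
  sequential A -> x_ @ \oo --> x ->
  exists2 h : A -> X, continuous h & h a = x /\ forall n, h (a_ n) = x_ n.
Proof.
move=> sA xx; have [h [hD hnD]] := test_split x_ x; have [_ _ Da _] := test.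
exists h; last first.
  by split=> [|n]; [apply: hnD; exact: test_limit|exact: hD].
apply: sequential_continuous => // z_ z zz; apply/cvg_seqP => U oU.
have [[n Dn]|nD] := pselect (exists n, D n z).
  rewrite (hD n) // => Un.
  by apply: filterS (test_near Dn zz) => k Dk; rewrite (hD n).
have {}nD n : ~ D n z by move=> Dn; apply: nD; exists n.
rewrite hnD // => Ux; have /cvg_seqP/(_ U oU Ux)[N _ NU] := xx.
apply: filterS (test_far N nD zz) => k Hk.
have [[n Dn]|nDk] := pselect (exists n, D n (z_ k)).
  by rewrite (hD n) //; apply: NU; exact: Hk.
by rewrite hnD // => n Dn; apply: nDk; exists n.
Qed.

End TestSequence.

(** Uncountability yields a non-isolated [x] and a nontrivial sequence converging to it. Its terms
    are separated by the first coordinate at which they differ from [x]. *)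
Lemma baire_test (A : topologicalType) (e : A -> nat -> nat) :
  qcb0 A -> (forall n, continuous (e ^~ n)) ->
  (forall x y, e x =1 e y -> x = y) -> (forall f, exists x, e x =1 f) ->
  exists a_ a D, @test_sequence A a_ a D.
Proof.
move=> qA ce inj surj.
have [x nx] : exists x : A, ~ open [set x].
  apply: contrapT => H.
  have [|g ginj] := qcb0_discrete_countable qA.
    by move=> x; apply: contrapT => nx; apply: H; exists x.
  (* Cantor's diagonal argument *)
  have /choice[v vP] : forall n, exists v, forall x, g x = n -> e x n <> v.
    move=> n; have [[x xn]|nn] := pselect (exists x, g x = n).
      exists (e x n).+1 => y yn; have -> : y = x by apply: ginj; rewrite yn.
      by apply/eqP; rewrite ltn_eqF.
    by exists 0 => y yn; case: nn; exists y.
  have [y ey] := surj v.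
  by have := vP (g y) y erefl; rewrite ey.
have [u ux unx] : exists2 u : nat -> A, u @ \oo --> x & ~ \forall n \near \oo, u n = x.
  apply: contrapT => H; apply: nx; apply: (qcb0_sequential qA) => u _ -> ux.
  by apply: contrapT => unx; apply: H; exists u.
have [phi le_phi nphi] := not_near_ooP unx.
pose u' n := u (phi n).
have u'x : u' @ \oo --> x by exact: cvg_subseq.
pose first_diff k : set A := [set y | (forall i, i < k -> e y i = e x i) /\ e y k <> e x k].
have clopen_agree_x k := clopen_agree (e x) k ce.
have disj n m z : first_diff n z -> first_diff m z -> n = m.
  move=> [n1 n2] [m1 m2]; case: (ltngtP n m) => // [nm|mn].
    by case: n2; exact: m1.
  by case: m2; exact: n1.
have clopen_diff n : clopen (first_diff n).
  rewrite (_ : first_diff n = [set y | forall i, i < n -> e y i = e x i] `&`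
    ~` [set y | e y n = e x n]); last by [].
  apply: clopenI; first exact: clopen_agree_x.
  apply: (@clopenC _ _ set0).
  exact: (clopen_fiber (f := fun y => e y n)) (ce n).
have diff_ex y : y <> x -> exists k, first_diff k y.
  move=> yx.
  have ex : exists k, e y k != e x k.
    apply: contrapT => H; apply: yx; apply: inj => k; apply/eqP/negPn/negP => ne.
    by apply: H; exists k.
  exists (ex_minn ex); case: ex_minnP => k kP kmin; split; last exact/eqP.
  move=> i ik; apply/eqP/negPn/negP => /kmin.
  by rewrite leqNgt ik.
have /choice[w wP] : forall N, exists nd : nat * nat,
    [/\ N <= nd.1, N <= nd.2 & first_diff nd.2 (u' nd.1)].
  move=> N.
  (* From [M] on, the sequence agrees with [x] below [N], so a first difference is at least [N]. *)
  have /cvg_seqP/(_ _ (clopen_agree_x N).1 (fun _ _ => erefl)) [M _ HM] := u'x.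
  have [d dP] := diff_ex _ (nphi (maxn M N)).
  exists (maxn M N, d); split => //=; first exact: leq_maxr.
  rewrite leqNgt; apply/negP => dN; case: dP => _; apply.
  by apply: HM dN => /=; exact: leq_maxl.
(* Each search starts beyond the previous first difference, so these increase strictly and the
   chosen clopen sets are disjoint. *)
pose psi := fix psi k := if k is k'.+1 then (w (psi k')).2.+1 else 0.
have psiS k : psi k.+1 = (w (psi k)).2.+1 by [].
have lt_d : {homo (fun k => (w (psi k)).2) : k l / k < l}.
  apply: homo_ltn => [k l m|k]; first exact: ltn_trans.
  by have [_ + _] := wP (psi k.+1); rewrite psiS.
have le_psi k : k <= psi k.
  elim: k => // k IH; rewrite psiS ltnS; have [_ + _] := wP (psi k).
  exact: leq_trans.
exists (fun k => u' (w (psi k)).1), x, (fun k => first_diff (w (psi k)).2); split.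
- apply: (cvg_subseq (phi := fun k => (w (psi k)).1)) u'x => k.
  by have [+ _ _] := wP (psi k); exact: leq_trans.
- by move=> k; exact: clopen_diff.
- by move=> k; have [] := wP (psi k).
- move=> k l z zk /(disj _ _ _ zk) kl.
  by have [/lt_d|/lt_d|] := ltngtP k l => //=; rewrite kl ltnn.
Qed.

(** Enough objects for universal properties in [K] to determine convergence: maps from the one-point
    object are points, maps from [A] carry convergent sequences. *)
Record testable (K : space_class) : Prop := Testable {
  testable_seq : forall X, K X -> sequential X;
  testable_point : exists (T : topologicalType) (t : T), K T /\ forall s : T, s = t;
  testable_test : exists (A : topologicalType) a_ a D, K A /\ @test_sequence A a_ a D }.

Lemma prod_is_product (K : space_class) (P X Y : topologicalType)
    (p : continuousType P X) (q : continuousType P Y) :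
  (forall W, K W -> sequential W) -> K P -> prod_spec p q -> is_product K p q.
Proof.
move=> sK KP pq; split=> // W KW f g.
have /choice[h hP] : forall w, exists v, p v = f w /\ q v = g w.
  by move=> w; have [v] := prod_pair pq (f w) (g w); exists v.
have ch : continuous h.
  apply: sequential_continuous; first exact: sK.
  move=> u w uw; apply: (prod_cvg pq).
    rewrite (hP _).1; under eq_fun do rewrite (hP _).1.
    by apply: cvg_map_seq uw; exact: cts_fun.
  rewrite (hP _).2; under eq_fun do rewrite (hP _).2.
  by apply: cvg_map_seq uw; exact: cts_fun.
exists (to_cts ch); split.
  by split=> w /=; have [] := hP w.
move=> h' [h'1 h'2]; apply/continuousEP => w.
by apply: (prod_inj pq); [have := h'1 w|have := h'2 w] => /= ->; have [] := hP w.
Qed.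

Lemma cts_app (X Y : topologicalType) (f g : continuousType X Y) (x : X) :
  f = g -> f x = g x.
Proof. by move=> ->. Qed.

Lemma is_product_inj (K : space_class) (T P X Y : topologicalType) (t : T)
    (p : continuousType P X) (q : continuousType P Y) (w w' : P) :
  K T -> is_product K p q -> p w = p w' -> q w = q w' -> w = w'.
Proof.
move=> KT [_ univ] pw qw.
have [h [_ hU]] := univ T KT (cst (p w)) (cst (q w)).
have hw : h = cst w by exact: hU.
have hw' : h = cst w' by apply: hU; split=> s /=.
by rewrite -[LHS](cts_app t hw) (cts_app t hw').
Qed.

(** Both component sequences extend to continuous maps on [A]; their pairing carries the test
    sequence to [w_]. *)
Lemma is_product_spec (K : space_class) (P X Y : topologicalType)
    (p : continuousType P X) (q : continuousType P Y) :
  testable K -> is_product K p q -> prod_spec p q.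
Proof.
move=> [sK [T [t [KT _]]] [A [a_ [a [D [KA tA]]]]]] pq.
have inj := is_product_inj t KT pq.
have [KP univ] := pq; split; [exact: cts_fun|exact: cts_fun|exact: inj| |].
  move=> x y; have [h [[h1 h2] _]] := univ T KT (cst x) (cst y).
  by exists (h t); [exact: (h1 t)|exact: (h2 t)].
move=> w_ w pw qw.
have [f cf [fa fan]] := test_map tA (sK _ KA) pw.
have [g cg [ga gan]] := test_map tA (sK _ KA) qw.
have [h [[h1 h2] _]] := univ A KA (to_cts cf) (to_cts cg).
have -> : w_ = fun n => h (a_ n).
  apply/funext => n; apply: inj.
    by have := h1 (a_ n) => /= ->; rewrite /to_cts /= /mkcts fan.
  by have := h2 (a_ n) => /= ->; rewrite /to_cts /= /mkcts gan.
have -> : w = h a.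
  apply: inj.
    by have := h1 a => /= ->; rewrite /to_cts /= /mkcts fa.
  by have := h2 a => /= ->; rewrite /to_cts /= /mkcts ga.
apply: cvg_map_seq; first exact: cts_fun.
by have [] := tA.
Qed.

(** The universal property ranges over every product [Q] in [K]; by [is_product_spec] convergence in
    [Q] is componentwise, so [exp_curry] applies. *)
Lemma exp_is_exponential (K : space_class) (Y Z E P : topologicalType)
    (p : continuousType P E) (q : continuousType P Y) (ev : E -> Y -> Z) :
  testable K -> K Y -> K E -> K P -> exp_spec ev -> prod_spec p q ->
  exists evP : continuousType P Z, is_exponential K p q evP.
Proof.
move=> tK KY KE KP X pq; have sK := testable_seq tK.
have cev : continuous (fun w => ev (p w) (q w)).
  apply: sequential_continuous; first exact: sK.
  move=> u w uw; apply: (exp_ev X); apply: cvg_map_seq uw; exact: cts_fun.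
exists (to_cts cev); split=> //; first exact: prod_is_product.
move=> A Q r s KA Qprod f.
have KQ : K Q by have [] := Qprod.
have rs := is_product_spec tK Qprod.
have /choice[pr prP] : forall ay : A * Y, exists w, r w = ay.1 /\ s w = ay.2.
  by move=> [x y]; have [w] := prod_pair rs x y; exists w.
have prK w : pr (r w, s w) = w.
  by apply: (prod_inj rs); rewrite ?(prP _).1 ?(prP _).2.
have [|h ch hE] := exp_curry (F := fun a y => f (pr (a, y))) (sK _ KY) (sK _ KA) X.
  move=> a_ a y_ y aa yy; apply: cvg_map_seq; first exact: cts_fun.
  apply: (prod_cvg rs).
    by rewrite (prP _).1; under eq_fun do rewrite (prP _).1.
  by rewrite (prP _).2; under eq_fun do rewrite (prP _).2.
have chr : continuous (fun w => h (r w)).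
  by move=> w; apply: continuous_comp; [exact: cts_fun|exact: ch].
have [_ univP] := prod_is_product sK KP pq.
have [u [[u1 u2] _]] := univP Q KQ (to_cts chr) s.
exists (to_cts ch); split.
  exists u; split=> // w /=; have := u1 w; have := u2 w.
  by rewrite /to_cts /= /mkcts => -> ->; rewrite hE prK.
move=> h' [u' [u'1 u'2 u'3]]; apply/continuousEP => a; apply: (exp_inj X) => y.
have [w rw sw] := prod_pair rs a y.
have := u'3 w; have := u'2 w; have := u'1 w.
rewrite /to_cts /= /mkcts => -> ->; rewrite rw sw => ->.
by rewrite hE -rw -sw prK.
Qed.

(** The map out of [nat] gives a point; comparing it with constant maps gives uniqueness. *)
Lemma terminal_point (K : space_class) (T : topologicalType) :
  K nat -> is_terminal K T -> exists t : T, forall s : T, s = t.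
Proof.
move=> Kn [KT univ]; have [f [_ fU]] := univ nat Kn.
exists (f 0) => s.
exact: esym (cts_app 0 (fU (cst s) I)).
Qed.

(** [nat] is its own product with the one-point [T], so the universal property at [T] identifies the
    points of [E] with functions from [nat] to [nat], and [baire_test] applies. *)
Lemma exponential_nat_test (K : space_class) (T E P : topologicalType) (t : T)
    (p : continuousType P E) (q : continuousType P nat) (ev : continuousType P nat) :
  full_subcategory K qcb0 -> K T -> (forall s : T, s = t) -> K nat ->
  is_exponential K p q ev -> exists a_ a D, @test_sequence E a_ a D.
Proof.
move=> Kq KT tT Kn [KE pq univ].
have inj := is_product_inj t KT pq.
(* [hn n] is the map e |-> (e, n), through which [ev] becomes evaluation at [n]. *)
have /choice[hn hnP] : forall n, exists h : continuousType E P,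
    p \o h =1 id /\ q \o h =1 (fun=> n).
  move=> n; have [_ /(_ E KE idfun (cst n))[h [hP _]]] := pq; by exists h.
have pnat : is_product K (cst t : continuousType nat T) (idfun : continuousType nat nat).
  split=> // W KW f g; exists g; split.
    by split=> w //=; rewrite (tT (f w)).
  by move=> h [_ hg]; apply/continuousEP => w; rewrite -hg.
have {}univ := univ T nat _ _ KT pnat.
have cn (X : topologicalType) (f : nat -> X) : continuous f.
  by apply/continuousP => A _; exact: discrete_open.
apply: (@baire_test E (fun x n => ev (hn n x))).
- exact: Kq.
- by move=> n x; apply: continuous_comp; exact: cts_fun.
- move=> x y exy.
  have [h [_ hU]] := univ (to_cts (cn _ (fun n => ev (hn n x)))).
  have hx z : (forall n, ev (hn n z) = ev (hn n x)) -> h = cst z.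
    move=> zx; apply: hU; exists (to_cts (cn _ (fun n => hn n z))); split => n /=.
    - by have [/(_ z)] := hnP n.
    - by have [_ /(_ z)] := hnP n.
    - exact: zx.
  rewrite -[LHS](cts_app t (hx x (fun _ => erefl))).
  exact: (cts_app t (hx y (fun n => esym (exy n)))).
- move=> f; have [h [[u [u1 u2 u3]] _]] := univ (to_cts (cn _ f)).
  exists (h t) => n; rewrite -[RHS]u3 /=; congr (ev _); apply: inj.
    by have [/(_ (h t)) /= -> _] := hnP n; have /= -> := u1 n.
  by have [_ /(_ (h t)) /= ->] := hnP n; have /= -> := u2 n.
Qed.

(** Transposing maps from the one-point object gives the points of [E]; transposing maps from the
    test object gives convergence. *)
Lemma is_exponential_spec (K : space_class) (Y E P : topologicalType)
    (p : continuousType P E) (q : continuousType P Y) (ev : continuousType P nat) :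
  testable K ->
  (forall A, K A -> exists (Q : topologicalType) (r : continuousType Q A)
    (s : continuousType Q Y), is_product K r s) ->
  is_exponential K p q ev -> K Y -> exists ev' : E -> Y -> nat, exp_spec ev'.
Proof.
move=> tK prods [KE pq univ] KY; have sK := testable_seq tK.
have sp := is_product_spec tK pq.
have /choice[pr prP] : forall ey : E * Y, exists w, p w = ey.1 /\ q w = ey.2.
  by move=> [x y]; have [w] := prod_pair sp x y; exists w.
pose ev' e y := ev (pr (e, y)).
have prK w : pr (p w, q w) = w.
  by apply: (prod_inj sp); rewrite ?(prP _).1 ?(prP _).2.
have evc e_ e y_ y : e_ @ \oo --> e -> y_ @ \oo --> y ->
    (fun n => ev' (e_ n) (y_ n)) @ \oo --> ev' e y.
  move=> ee yy; apply: cvg_map_seq; first exact: cts_fun.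
  apply: (prod_cvg sp).
    by rewrite (prP _).1; under eq_fun do rewrite (prP _).1.
  by rewrite (prP _).2; under eq_fun do rewrite (prP _).2.
have curry (A : topologicalType) (KA : K A) (F : A -> Y -> nat) :
    (forall a_ a y_ y, a_ @ \oo --> a -> y_ @ \oo --> y ->
      (fun n => F (a_ n) (y_ n)) @ \oo --> F a y) ->
    exists h : continuousType A E, (forall a y, ev' (h a) y = F a y) /\
      forall h' : continuousType A E, (forall a y, ev' (h' a) y = F a y) -> h = h'.
  move=> cF; have [Q [r [s rsK]]] := prods A KA.
  have rs := is_product_spec tK rsK.
  have cf : continuous (fun w => F (r w) (s w)).
    apply: sequential_continuous; first by apply: sK; have [] := rsK.
    by move=> u w uw; apply: cF; apply: cvg_map_seq uw; exact: cts_fun.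
  have [h [[u [u1 u2 u3]] hU]] := univ A Q r s KA rsK (to_cts cf).
  exists h; split.
    move=> a y; have [w <- <-] := prod_pair rs a y.
    apply: etrans (u3 w) => /=; congr (ev _); apply: (prod_inj sp).
      by rewrite (prP _).1; have /= -> := u1 w.
    by rewrite (prP _).2; have /= -> := u2 w.
  move=> h' h'F; apply: hU.
  have chr : continuous (fun w => h' (r w)).
    by move=> w; apply: continuous_comp; exact: cts_fun.
  have KQ : K Q by have [] := rsK.
  have [_ /(_ Q KQ (to_cts chr) s)[u' [[u'1 u'2] _]]] := pq.
  exists u'; split=> // w /=.
  rewrite -(prK (u' w)); have /= -> := u'1 w; have /= -> := u'2 w.
  exact: h'F.
have [T [t [KT tT]]] := testable_point tK.
have Tcst (e : E) : forall a_ (a : T) y_ y, a_ @ \oo --> a -> y_ @ \oo --> y ->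
    (fun n => ev' e (y_ n)) @ \oo --> ev' e y.
  by move=> a_ a y_ y _ yy; apply: (evc (fun=> e)) yy; exact: cvg_cst.
have inj e e' : ev' e =1 ev' e' -> e = e'.
  move=> ee'.
  have [h [_ hU]] := curry T KT (fun _ => ev' e) (Tcst e).
  rewrite -[LHS](cts_app t (hU (cst e) (fun _ _ => erefl))).
  exact: (cts_app t (hU (cst e') (fun _ y => esym (ee' y)))).
exists ev'; split=> //.
- move=> f cf.
  have [|h [hP _]] := curry T KT (fun _ => f).
    by move=> a_ a y_ y _ yy; exact: cvg_map_seq yy.
  by exists (h t) => y; exact: hP.
- move=> e_ e He.
  have [A [a_ [a [D [KA tA]]]]] := testable_test tK.
  (* The transpose of [F] sends [a_ n] to [e_ n] and [a] to [e], so its continuity yields the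
     convergence of [e_]. *)
  have [F [FD FnD]] := test_split tA (fun n => ev' (e_ n)) (ev' e).
  have [_ _ Da _] := tA.
  have [|h [hP _]] := curry A KA F.
    move=> z_ z y_ y zz yy.
    have evy e' : \forall k \near \oo, ev' e' (y_ k) = ev' e' y.
      by apply/cvg_natP; apply: (evc (fun=> e')) yy; exact: cvg_cst.
    have [[n Dn]|nD] := pselect (exists n, D n z).
      rewrite (FD n) //; apply/cvg_natP.
      by apply: filterS2 (test_near tA Dn zz) (evy (e_ n)) => k Dk; rewrite (FD n).
    have {}nD n : ~ D n z by move=> Dn; apply: nD; exists n.
    rewrite FnD //; apply/cvg_natP.
    (* The index [n] of the set containing [z_ k] is unrelated to [k], hence a bound uniform in
       both. *)
    have [|N HN] := continuous_cvg_joint (F := fun n => ev' (e_ n)) (m := ev' e y) _ yy.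
      by move=> y' /He/cvg_natP.
    have HN' : \forall k \near \oo, N <= k by exists N.
    apply: filterS3 (test_far tA N nD zz) (evy e) HN' => k Hk ek Nk.
    have [[n Dn]|nDk] := pselect (exists n, D n (z_ k)).
      by rewrite (FD n) //; apply: HN => //; exact: Hk.
    by rewrite FnD // => n Dn; apply: nDk; exists n.
  have -> : e_ = fun n => h (a_ n).
    by apply/funext => n; apply: inj => y; rewrite hP (FD n).
  have -> : e = h a.
    by apply: inj => y; rewrite hP FnD // => n Dn; exact: (test_limit tA Dn).
  by have [aa _ _ _] := tA; apply: cvg_map_seq aa; exact: cts_fun.
Qed.

Lemma qcb0_testable (K : space_class) (T A : topologicalType) (t : T)
    (a_ : nat -> A) (a : A) (D : nat -> set A) :
  full_subcategory K qcb0 -> K T -> (forall s : T, s = t) -> K A ->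
  test_sequence a_ a D -> testable K.
Proof.
move=> Kq KT tT KA tA; split; first by move=> X /Kq; exact: qcb0_sequential.
  by exists T, t.
by exists A, a_, a, D.
Qed.

(** * The Kleene-Kreisel subcategory and its minimality *)

Lemma kleene_kreisel_categoryP (X : topologicalType) :
  kleene_kreisel_category X <-> exists k, X = level k.
Proof.
split=> [[->|[k ->]]|[[|k] ->]]; [by exists 0|by exists k.+1|by left|].
by right; exists k.
Qed.

Lemma kleene_kreisel_category_level (k : nat) : kleene_kreisel_category (level k).
Proof. by apply/kleene_kreisel_categoryP; exists k. Qed.

Lemma one_space_terminal (K : space_class) : K one_space -> is_terminal K one_space.
Proof.
move=> K1; split=> // X KX; exists (cst tt); split=> // f _.
by apply/continuousEP => x; exact: one_spaceE.
Qed.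

Lemma kleene_kreisel_qcb0 : full_subcategory kleene_kreisel_category qcb0.
Proof. by move=> X /kleene_kreisel_categoryP[k ->]; exact: qcb0_level. Qed.

Lemma kleene_kreisel_testable : testable kleene_kreisel_category.
Proof.
have [_ _ [ev X]] := level_spec 1.
have [|||a_ [a [D tA]]] := @baire_test (level 2) ev (qcb0_level 2).
- by move=> n; exact: exp_continuous_at (@sequential_level 2) X.
- by move=> x y; exact: (exp_inj X).
- move=> f; apply: (exp_fun X).
  by apply/continuousP => A _; exact: discrete_open.
apply: (@qcb0_testable _ one_space (level 2) tt a_ a D) tA.
- exact: kleene_kreisel_qcb0.
- exact: (kleene_kreisel_category_level 0).
- by move=> s; exact: one_spaceE.
- exact: (kleene_kreisel_category_level 2).
Qed.

(** [K] is left free to cover products both among Kleene-Kreisel spaces and in [qcb0]. *)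
Lemma kleene_kreisel_prod (K : space_class) (X Y : topologicalType) :
  (forall W, K W -> sequential W) -> full_subcategory kleene_kreisel_category K ->
  kleene_kreisel_category X -> kleene_kreisel_category Y ->
  exists (P : topologicalType) (p : continuousType P X) (q : continuousType P Y),
    [/\ kleene_kreisel_category P, prod_spec p q & is_product K p q].
Proof.
move=> sK FK /kleene_kreisel_categoryP[i ->] /kleene_kreisel_categoryP[j ->].
have [m [p [q pq]]] := level_prod i j.
exists (level m), (to_cts (prod_fst pq)), (to_cts (prod_snd pq)); split=> //.
  exact: kleene_kreisel_category_level.
apply: prod_is_product => //; apply: FK; exact: kleene_kreisel_category_level.
Qed.

Lemma kleene_kreisel_cartesian_closed : cartesian_closed kleene_kreisel_category.
Proof.
have tF := kleene_kreisel_testable; have sF := testable_seq tF.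
split.
- exists one_space; apply: one_space_terminal.
  exact: (kleene_kreisel_category_level 0).
- move=> X Y FX FY.
  have [//|P [p [q [_ _ pq]]]] := kleene_kreisel_prod sF _ FX FY.
  by exists P, p, q.
- move=> Y Z FY FZ.
  have [E FE [ev X]] : exists2 E, kleene_kreisel_category E &
      exists ev : E -> Y -> Z, exp_spec ev.
    move: FY FZ => /kleene_kreisel_categoryP[j ->] /kleene_kreisel_categoryP[i ->].
    have [m [ev X]] := level_exp j i; exists (level m); last by exists ev.
    exact: kleene_kreisel_category_level.
  have [//|P [p [q [FP pq _]]]] := kleene_kreisel_prod sF _ FE FY.
  have [evP XP] := exp_is_exponential tF FY FE FP X pq.
  by exists E, P, p, q, evP.
Qed.

(** By induction from the terminal object: the exponential in [C] of [nat] by a copy of [level k]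
    carries continuous convergence, hence is a copy of [level k.+1]. *)
Lemma kleene_kreisel_minimal (C : space_class) :
  full_subcategory C qcb0 -> cartesian_closed C -> C nat ->
  forall k, exists2 Y, C Y & homeomorphic (level k) Y.
Proof.
move=> Cq [[T termT] prods exps] Cn.
have [CT _] := termT; have [t tT] := terminal_point Cn termT.
have tC : testable C.
  have [E [P [p [q [ev X]]]]] := exps nat nat Cn Cn.
  have [a_ [a [D tA]]] := exponential_nat_test Cq CT tT Cn X.
  by have [CE _ _] := X; exact: (qcb0_testable Cq CT tT CE tA).
elim=> [|k [Y CY kY]].
  exists T => //; exists (cst t), (cst tt); split=> x; first exact: one_spaceE.
  by rewrite (tT x).
have [E [P [p [q [ev X]]]]] := exps Y nat CY Cn.
have [CE _ _] := X; exists E => //.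
have [ev' X'] := is_exponential_spec tC (fun A CA => prods A Y CA CY) X CY.
have [_ _ [evk Xk]] := level_spec k.
exact: (exp_homeomorphic (@sequential_level k.+1) (testable_seq tC CE)
  (@sequential_level k) (testable_seq tC CY) Xk X' kY).
Qed.

Theorem theorem7p6 :
  [/\ full_subcategory kleene_kreisel_category qcb0,
      cartesian_closed kleene_kreisel_category &
      closed_under_finite_products qcb0 kleene_kreisel_category] /\
  (forall C : space_class,
     full_subcategory C qcb0 ->
     cartesian_closed C ->
     closed_under_finite_products qcb0 C ->
     C nat ->
     forall X : topologicalType, kleene_kreisel_category X ->
       exists2 Y : topologicalType, C Y & homeomorphic X Y).
Proof.
split; last first.
  move=> C Cq cC _ Cn X /kleene_kreisel_categoryP[k ->].
  exact: kleene_kreisel_minimal.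
split; [exact: kleene_kreisel_qcb0|exact: kleene_kreisel_cartesian_closed|split].
  exists one_space; first exact: (kleene_kreisel_category_level 0).
  exact: one_space_terminal (qcb0_level 0).
move=> X Y FX FY.
have [P [p [q [FP _ pq]]]] :=
  kleene_kreisel_prod qcb0_sequential kleene_kreisel_qcb0 FX FY.
by exists P, p, q.
Qed.
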